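(* Let $d\ge1$ be an integer, $\alpha>0$ and $\theta\in(0,1)$. For $A,B,C\in\mathcal{M}(\mathbb{R}^d)$ and $\mathbf{z}=(z_1,z_2)\in\mathbb{R}^{d}\times\mathbb{R}^d=\mathbb{R}^{2d}$ define $$x_1=J_{\alpha A}(z_1),\qquad x_2=J_{\alpha B}(x_1+z_2),\qquad x_3=J_{\alpha C}(x_1-z_1+x_2-z_2),$$ $$T_1(\mathbf{z})=z_1+\theta(x_3-x_1),\qquad T_2(\mathbf{z})=z_2+\theta(x_3-x_2),$$ $$\mathbf{T}(A,B,C,\mathbf{z})=(T_1(\mathbf{z}),T_2(\mathbf{z}))\in\mathbb{R}^{2d},\qquad S(A,B,C,\mathbf{z})=\tfrac13(x_1+x_2+x_3)\in\mathbb{R}^d .$$ Then $(\mathbf{T},S)$ is a fixed-point encoding for the problem class (3op-$\mathbb{R}^d$), and $(\mathbf{T},S)$ converges unconditionally for (3op-$\mathbb{R}^d$).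
   Context: $\mathcal{M}(\mathbb{R}^d)$ is the set of all maximal monotone (set-valued) operators on $\mathbb{R}^d$ (with the Euclidean inner product). For $A\in\mathcal{M}(\mathbb{R}^d)$ and $\alpha>0$, $J_{\alpha A}=(I+\alpha A)^{-1}:\mathbb{R}^d\to\mathbb{R}^d$ is the resolvent. For an operator $D$ on $\mathbb{R}^d$, $\operatorname{zer} D=\{x\in\mathbb{R}^d: 0\in Dx\}$. Problem class (3op-$\mathbb{R}^d$): all problems of finding $x\in\mathbb{R}^d$ with $0\in(A+B+C)x$, where $A,B,C\in\mathcal{M}(\mathbb{R}^d)$. Fixed-point encoding: a pair $(\mathbf{T},S)$ with $\mathbf{T}:\mathcal{M}(\mathbb{R}^d)^3\times\mathbb{R}^{d'}\to\mathbb{R}^{d'}$ and $S:\mathcal{M}(\mathbb{R}^d)^3\times\mathbb{R}^{d'}\to\mathbb{R}^{d}$ is a fixed-point encoding for (3op-$\mathbb{R}^d$) if for all $A,B,C\in\mathcal{M}(\mathbb{R}^d)$ and all $x^\star\in\mathbb{R}^d$: there exists $\mathbf{z}^\star\in\mathbb{R}^{d'}$ with $\mathbf{T}(A,B,C,\mathbf{z}^\star)=\mathbf{z}^\star$ and $S(A,B,C,\mathbf{z}^\star)=x^\star$ if and only if $0\in(A+B+C)(x^\star)$. Here $d'=2d$. Unconditional convergence: $(\mathbf{T},S)$ converges unconditionally for (3op-$\mathbb{R}^d$) if for all $A,B,C\in\mathcal{M}(\mathbb{R}^d)$ with $\operatorname{zer}(A+B+C)\neq\emptyset$ and every $\mathbf{z}^0\in\mathbb{R}^{d'}$,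 the sequence of iterates $\mathbf{z}^{k+1}=\mathbf{T}(A,B,C,\mathbf{z}^k)$ converges, as $k\to\infty$, to some $\mathbf{z}^\star\in\mathbb{R}^{d'}$ with $S(A,B,C,\mathbf{z}^\star)\in\operatorname{zer}(A+B+C)$. *)

(* Defs.v *)
From mathcomp Require Import all_boot all_order all_algebra.
From mathcomp Require Import all_classical all_reals all_analysis.
Import Order.TTheory GRing.Theory Num.Theory numFieldNormedType.Exports.

Set Implicit Arguments.
Unset Strict Implicit.
Unset Printing Implicit Defensive.

Local Open Scope classical_set_scope.
Local Open Scope ring_scope.

Section Operators.
Context {R : realType} {d : nat}.

(* [dotmx] of MathComp's spectral.v needs a numClosedFieldType, so it is not
   available over the reals. *)
Definition dot (u v : 'rV[R]_d) : R := \sum_(i < d) u 0 i * v 0 i.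

Definition operator := 'rV[R]_d -> set 'rV[R]_d.

Implicit Types (A B D : operator).

Definition op_id : operator := fun x => [set x].
Definition op_add A B : operator :=
  fun x => [set u + v | u in A x & v in B x].
Definition op_scale (a : R) A : operator := fun x => [set a *: u | u in A x].
Definition op_inv A : operator := fun u => [set x | A x u].

Definition zer D : set 'rV[R]_d := [set x | D x 0].

Definition monotone_op A : Prop :=
  forall x y u v, A x u -> A y v -> 0 <= dot (x - y) (u - v).

(* Monotone, with no monotone operator whose graph properly contains that
   of A. *)
Definition maximal_monotone A : Prop :=
  monotone_op A /\
  forall B, monotone_op B -> (forall x, A x `<=` B x) ->
    forall x, B x `<=` A x.

Record maxmon := MaxMon {
  maxmon_op :> operator;
  maxmonP : maximal_monotone maxmon_op }.

(* The resolvent (I + D)^-1 as a function: [xget] selects an element of the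
   set (I + D)^-1 z.  For D = alpha A with A maximal monotone and alpha > 0
   that set is a singleton by Minty's theorem, so neither the choice nor the
   default value 0 matters. *)
Definition resolvent D (z : 'rV[R]_d) : 'rV[R]_d :=
  xget 0 (op_inv (op_add op_id D) z).

End Operators.

Arguments operator : clear implicits.
Arguments maxmon : clear implicits.

Section Encodings.
Context {R : realType} {d d' : nat}.

Variable T : maxmon R d -> maxmon R d -> maxmon R d -> 'rV[R]_d' -> 'rV[R]_d'.
Variable S : maxmon R d -> maxmon R d -> maxmon R d -> 'rV[R]_d' -> 'rV[R]_d.

Definition fixed_point_encoding : Prop :=
  forall (A B C : maxmon R d) (x : 'rV[R]_d),
    (exists z : 'rV[R]_d', T A B C z = z /\ S A B C z = x) <->
    op_add (op_add A B) C x 0.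

Definition converges_unconditionally : Prop :=
  forall A B C : maxmon R d,
    zer (op_add (op_add A B) C) !=set0 ->
    forall z0 : 'rV[R]_d',
      exists2 z : 'rV[R]_d',
        (fun k : nat => iter k (T A B C) z0) @ \oo --> z &
        zer (op_add (op_add A B) C) (S A B C z).

End Encodings.

Section Splitting.
Context {R : realType} {d : nat}.
Variables (alpha theta : R).
Variables (A B C : maxmon R d).

(* A vector z of R^(2d) is row_mx z1 z2, with z1 = lsubmx z, z2 = rsubmx z. *)
Implicit Types z : 'rV[R]_(d + d).

Definition split_x1 z : 'rV[R]_d :=
  resolvent (op_scale alpha A) (lsubmx z).
Definition split_x2 z : 'rV[R]_d :=
  resolvent (op_scale alpha B) (split_x1 z + rsubmx z).
Definition split_x3 z : 'rV[R]_d :=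
  resolvent (op_scale alpha C)
    (split_x1 z - lsubmx z + split_x2 z - rsubmx z).

Definition split_T z : 'rV[R]_(d + d) :=
  row_mx (lsubmx z + theta *: (split_x3 z - split_x1 z))
         (rsubmx z + theta *: (split_x3 z - split_x2 z)).

Definition split_S z : 'rV[R]_d :=
  3^-1 *: (split_x1 z + split_x2 z + split_x3 z).

End Splitting.

(* Main.v *)
Require Import Defs.
From mathcomp Require Import all_boot all_order all_algebra.
From mathcomp Require Import all_classical all_reals all_analysis.
From mathcomp Require Import ring lra.
Import Order.TTheory GRing.Theory Num.Theory numFieldNormedType.Exports.

(** The argument rests on one inequality.  Write x1, x2, x3 for the three
resolvent points at z and let z range over two values; all letters below
denote differences of the corresponding quantities.  Monotonicity of A, B and
C says
  <x1, z1 - x1> >= 0,   <x2, x1 + z2 - x2> >= 0,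
  <x3, x1 - z1 + x2 - z2 - x3> >= 0,
and twice the sum of the three rearranges to
  2<z1, x3 - x1> + 2<z2, x3 - x2> + |x3 - x1|^2 + |x3 - x2|^2
    <= - |x1 - x2|^2 <= 0.
For the step r = T z - z = theta (x3 - x1, x3 - x2) this reads
2<z, r> + |r|^2 / theta <= 0, that is,
  |z + r|^2 + (1 - theta) / theta * |r|^2 <= |z|^2.
So T is an averaged map ([split_T_averaged]; theta < 1 makes the constant
positive), and the iterates of an averaged map with a fixed point converge to
a fixed point ([averaged_iter_cvg], the Krasnoselskii-Mann theorem): their
distance to each fixed point decreases, the residual T z - z tends to 0, so
every cluster point is fixed, and the distance to that one then tends to 0.

Fixed points encode solutions ([split_fixedP]).  At a fixed point
x1 = x2 = x3 = x, and the three inclusions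
  z1 - x in alpha A x,   z2 in alpha B x,   x - z1 - z2 in alpha C x
add up to 0; conversely, a + b + c = 0 with a, b, c in A x, B x, C x gives the
fixed point (x + alpha a, alpha b).

Both parts need the resolvents to be everywhere defined, which is Minty's
theorem ([minty]).  After translation and scaling it asks for a c with
- c in A c; by maximality it suffices that <c - y, - c - v> >= 0 for every
(y, v) in the graph of A.  The left-hand side depends only on (y - v) / 2 and
<y, v>:
  <c - y, c + v> = |c|^2 - 2 <c, (y - v) / 2> - <y, v>.
The points ((y - v) / 2, <y, v>) lie in the image K of the epigraph of the
Fitzpatrick function of A under (x, u, p) |-> ((x - u) / 2, p).  K is convex,
and |c|^2 + p >= |x + u|^2 / 4 >= 0 on it because the Fitzpatrick function of
a maximal monotone operator dominates <x, u>.  The required inequality is the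
first-order optimality condition for the minimum of |c|^2 + p on K
([convex_variational_ineq]); K need not be closed, so the minimum is replaced
by a minimizing sequence. *)

Local Open Scope classical_set_scope.
Local Open Scope ring_scope.

(** * The Euclidean inner product and bounded sequences *)

Section Dot.
Context {R : realType} {n : nat}.
Implicit Types x y z : 'rV[R]_n.

Lemma dotC x y : dot x y = dot y x.
Proof. by apply: eq_bigr => i _; rewrite mulrC. Qed.

Lemma dotDl x y z : dot (x + y) z = dot x z + dot y z.
Proof. by rewrite -big_split; apply: eq_bigr => i _; rewrite mxE mulrDl. Qed.

Lemma dotZl (a : R) x y : dot (a *: x) y = a * dot x y.
Proof. by rewrite /dot mulr_sumr; apply: eq_bigr => i _; rewrite mxE mulrA. Qed.

Lemma dot0l x : dot 0 x = 0.
Proof. by rewrite -(scale0r 0) dotZl mul0r. Qed.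

Lemma dotNl x y : dot (- x) y = - dot x y.
Proof. by rewrite -scaleN1r dotZl mulN1r. Qed.

Lemma dotDr x y z : dot x (y + z) = dot x y + dot x z.
Proof. by rewrite dotC dotDl !(dotC x). Qed.

Lemma dotZr (a : R) x y : dot x (a *: y) = a * dot x y.
Proof. by rewrite dotC dotZl dotC. Qed.

Lemma dotNr x y : dot x (- y) = - dot x y.
Proof. by rewrite dotC dotNl dotC. Qed.

Definition dotE := (dotDl, dotDr, dotNl, dotNr, dotZl, dotZr).

Lemma dot_ge0 x : 0 <= dot x x.
Proof. by apply: sumr_ge0 => i _; rewrite -expr2 sqr_ge0. Qed.

Lemma sqr_coord_le_dot x i : x 0 i ^+ 2 <= dot x x.
Proof.
rewrite /dot (bigD1 i) //= -expr2 lerDl.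
by apply: sumr_ge0 => j _; rewrite -expr2 sqr_ge0.
Qed.

Lemma dot_eq0 x : dot x x <= 0 -> x = 0.
Proof.
move=> x0; apply/rowP => i; rewrite mxE; apply/eqP.
by rewrite -sqrf_eq0 eq_le sqr_ge0 andbT (le_trans (sqr_coord_le_dot x i)).
Qed.

(** The topology of row vectors comes from the sup norm; this bound and
[dot_le_norm] let every estimate be made with squared Euclidean norms, without
square roots. *)
Lemma norm_le_of_dot x (e : R) : 0 <= e -> dot x x <= e ^+ 2 -> `|x| <= e.
Proof.
move=> e0 xe; rewrite [`|x|]mx_normrE; apply: bigmax_le => // -[i j] _ /=.
rewrite ord1 -(@ler_pXn2r _ 2) ?nnegrE // real_normK ?num_real //.
exact: le_trans (sqr_coord_le_dot x j) xe.
Qed.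

Lemma dot_le_norm x : dot x x <= n%:R * `|x| ^+ 2.
Proof.
rewrite /dot -[X in X%:R]card_ord -sum1_card natr_sum mulr_suml.
apply: ler_sum => i _; rewrite mul1r -expr2 -real_normK ?num_real //.
rewrite ler_pXn2r ?nnegrE // [leRHS]mx_normrE.
exact: (le_bigmax _ (fun ij : 'I_1 * 'I_n => `|x ij.1 ij.2|) (0, i)).
Qed.

End Dot.

Lemma dot_row_mx {R : realType} {n m : nat} (a c : 'rV[R]_n) (b e : 'rV[R]_m) :
  dot (row_mx a b) (row_mx c e) = dot a c + dot b e.
Proof.
rewrite /dot big_split_ord /=; congr (_ + _); apply: eq_bigr => i _.
  by rewrite !row_mxEl.
by rewrite !row_mxEr.
Qed.

(** Bolzano-Weierstrass in the Euclidean distance, stated as recurrence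
near p, which is all that the approximation arguments below use; no
subsequence has to be extracted. *)
Lemma bounded_seq_cluster {R : realType} {n : nat} (u : nat -> 'rV[R]_n) (M : R) :
  (forall k, dot (u k) (u k) <= M) ->
  exists p, forall (e : R) N, 0 < e ->
    exists2 k, (N <= k)%N & dot (u k - p) (u k - p) < e.
Proof.
move=> uM.
have Kc : compact [set v : 'rV[R]_n | forall i, `[- (M + 1), M + 1]%classic (v ord0 i)].
  by apply: (@rV_compact _ _ (fun=> `[- (M + 1), M + 1]%classic)) => _;
    exact: segment_compact.
have uK k : [set v : 'rV[R]_n | forall i, `[- (M + 1), M + 1]%classic (v ord0 i)] (u k).
  move=> i /=; rewrite in_itv /= -ler_norml.
  have ui := le_trans (sqr_coord_le_dot (u k) i) (uM k).
  rewrite -real_normK ?num_real // in ui.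
  have := sqr_ge0 (`|u k 0 i| - 1); have := normr_ge0 (u k 0 i); nra.
have [p [_ up]] := Kc (u @ \oo) _ (filterS (fun k _ => uK k) filterT).
exists p => e N e0.
have d0 : 0 < e / (n%:R + 1) by rewrite divr_gt0 // ltr_pwDr.
set r := Num.sqrt (e / (n%:R + 1)).
have r0 : 0 < r by rewrite sqrtr_gt0.
have /up : (u @ \oo) (u @` [set k | (N <= k)%N]).
  by exists N => // k Nk; exists k.
move=> /(_ (ball p r) (nbhsx_ballx p r r0)) [_ [[k Nk <-]]].
rewrite -ball_normE /= distrC => kr; exists k => //.
apply: le_lt_trans (dot_le_norm _) _.
have : `|u k - p| ^+ 2 <= r ^+ 2 by rewrite ler_pXn2r ?nnegrE // ltW.
rewrite (sqr_sqrtr (ltW d0)) => kr2.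
apply: (@le_lt_trans _ _ (n%:R * (e / (n%:R + 1)))); first exact: ler_wpM2l.
rewrite mulrA ltr_pdivrMr ?ltr_pwDr // mulrC ltr_pM2l //.
by rewrite ltrDl.
Qed.

(** * Iterates of averaged maps *)

Section AveragedIteration.
Context {R : realType} {n : nat}.
Variables (T : 'rV[R]_n -> 'rV[R]_n) (kappa : R).
Hypothesis kappa_gt0 : 0 < kappa.
Hypothesis averaged : forall z w,
  dot (T z - T w) (T z - T w) +
  kappa * dot ((T z - z) - (T w - w)) ((T z - z) - (T w - w)) <=
  dot (z - w) (z - w).

(** Comparing with the fixed point w, the inequality bounds the squared
residual by the decrease of |u k - w|^2, a nonincreasing nonnegative sequence;
hence the residual tends to 0.  Being bounded, u comes back near some p, which
is then fixed, and |u k - p| is nonincreasing with arbitrarily small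
values. *)
Theorem averaged_iter_cvg w z0 : T w = w ->
  exists2 z, (fun k => iter k T z0) @ \oo --> z & T z = z.
Proof.
move=> Tw; pose u k := iter k T z0.
have uS k : u k.+1 = T (u k) by [].
have nonexp z v : dot (T z - T v) (T z - T v) <= dot (z - v) (z - v).
  apply: le_trans (averaged z v); rewrite lerDl mulr_ge0 ?dot_ge0 //; exact: ltW.
have fejer v : T v = v -> {homo (fun k => dot (u k - v) (u k - v)) :
    i j / (i <= j)%N >-> j <= i}.
  move=> Tv; apply/nonincreasing_seqP => k; rewrite uS -{1 2}Tv; exact: nonexp.
have step k : kappa * dot (T (u k) - u k) (T (u k) - u k) <=
    dot (u k - w) (u k - w) - dot (u k.+1 - w) (u k.+1 - w).
  have := averaged (u k) w; rewrite uS Tw subrr subr0; lra.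
have lb v : has_lbound (range (fun k => dot (u k - v) (u k - v))).
  by exists 0 => _ [k _ <-]; exact: dot_ge0.
have res (e : R) : 0 < e -> exists N, forall k, (N <= k)%N ->
    dot (T (u k) - u k) (T (u k) - u k) < e.
  move=> e0; set E := range (fun k => dot (u k - w) (u k - w)).
  have hE : has_inf E by by split; [exists (dot (u 0%N - w) (u 0%N - w)), 0%N | exact: lb].
  have [_ [N _ <-] Ne] := inf_adherent (mulr_gt0 kappa_gt0 e0) hE.
  exists N => k Nk; rewrite -(ltr_pM2l kappa_gt0); apply: le_lt_trans (step k) _.
  have h1 : inf E <= dot (u k.+1 - w) (u k.+1 - w) by apply: (ge_inf (lb w)); exists k.+1.
  have h2 := fejer w Tw N k Nk; lra.
have [p pP] : exists p, forall (e : R) N, 0 < e ->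
    exists2 k, (N <= k)%N & dot (u k - p) (u k - p) < e.
  apply: (@bounded_seq_cluster _ _ _ (2 * dot (u 0%N - w) (u 0%N - w) + 2 * dot w w)) => k.
  have := fejer w Tw _ _ (leq0n k); have := dot_ge0 (u k - w - w).
  by rewrite !dotE (dotC w (u k)); lra.
have Tp : T p = p.
  apply/eqP; rewrite -subr_eq0; apply/eqP/dot_eq0/ler_addgt0Pl => e e0.
  (* T p - p is a sum of three vectors of squared norm below e / 9. *)
  have e9 : 0 < e / 9 by lra.
  have [N NP] := res _ e9; have [k /NP rk pk] := pP _ N e9.
  have := nonexp (u k) p; move: rk pk.
  move: (T (u k)) => a; move: (T p) (u k) => b c.
  have := dot_ge0 (b - a - (a - c)); have := dot_ge0 (a - c - (c - p)).
  have := dot_ge0 (b - a - (c - p)).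
  rewrite !dotE (dotC b a) (dotC b c) (dotC b p) (dotC p a) (dotC p c) (dotC c a).
  lra.
exists p => //; apply/cvgrPdist_le => e e0.
have [k0 _ ke] := pP _ 0%N (exprn_gt0 2 e0).
exists k0 => // k /= kk; rewrite distrC; apply: norm_le_of_dot; first exact: ltW.
exact: le_trans (fejer p Tp _ _ kk) (ltW ke).
Qed.

End AveragedIteration.

(** * Minty's theorem *)

(** If the infimum m of |c|^2 + p over K is attained at (c, q), its
derivative towards a in K is nonnegative there:
  |c|^2 - 2<c, a.1> - a.2 <= - m <= 0.
In general, take a k in K within (t k)^2 of the infimum, with t k = 1/(k+1):
moving from a k towards a by the fraction t k loses at most (t k)^2, which
gives the inequality at a k up to O(t k) ([approx]).  By the parallelogram
law the a k have bounded first components ([bound]), and the inequality passes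
to a cluster point of these. *)
Lemma convex_variational_ineq {R : realType} {n : nat} (K : set ('rV[R]_n * R)) :
  K !=set0 ->
  (forall a b t, K a -> K b -> 0 <= t <= 1 ->
     K ((1 - t) *: a.1 + t *: b.1, (1 - t) * a.2 + t * b.2)) ->
  (forall a, K a -> 0 <= dot a.1 a.1 + a.2) ->
  exists c, forall a, K a -> dot c c - 2 * dot c a.1 - a.2 <= 0.
Proof.
move=> [a0 Ka0] Kcvx Kpos.
pose h (a : 'rV[R]_n * R) := dot a.1 a.1 + a.2.
pose m := inf (h @` K).
have lb : has_lbound (h @` K) by exists 0 => _ [a Ka <-]; exact: Kpos.
have hK : has_inf (h @` K) by split; [exists (h a0), a0 | exact: lb].
have m_ge0 : 0 <= m by apply: lb_le_inf => [|_ [a Ka <-]]; [exact: hK.1 | exact: Kpos].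
have m_le a : K a -> m <= h a by move=> Ka; apply: ge_inf => //; exists a.
pose t k : R := k.+1%:R^-1.
have t01 k : 0 < t k <= 1.
  by rewrite invr_gt0 ltr0Sn /= invf_le1 ?ltr0Sn // ler1n.
have tlim (e : R) : 0 < e -> exists N, forall k, (N <= k)%N -> t k < e.
  by move=> e0; have [N _ NP] := near_infty_natSinv_lt (PosNum e0); exists N.
have /choice[a aP] k : exists a, K a /\ h a < m + t k ^+ 2.
  have tk0 : 0 < t k ^+ 2 by rewrite exprn_gt0 //; have /andP[] := t01 k.
  by have [_ [a Ka <-] ak] := inf_adherent tk0 hK; exists a.
have approx b k : K b ->
    dot (a k).1 (a k).1 - 2 * dot (a k).1 b.1 - b.2 <=
    t k * (1 + dot ((a k).1 - b.1) ((a k).1 - b.1)).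
  move=> Kb; have [Ka hak] := aP k; have /andP[t0 t1] := t01 k.
  have t01' : 0 <= t k <= 1 by rewrite t1 ltW.
  have := m_le _ (Kcvx _ _ _ Ka Kb t01'); have := m_le _ Ka.
  move: hak; rewrite -(ler_pM2l t0) /h /= !dotE (dotC b.1 (a k).1).
  nra.
have bound k : dot ((a k).1 - a0.1) ((a k).1 - a0.1) <= 2 * (1 + h a0 + m).
  have [Ka hak] := aP k; have /andP[t0 t1] := t01 k.
  have half : 0 <= (1 / 2 : R) <= 1 by lra.
  have := m_le _ (Kcvx _ _ _ Ka Ka0 half).
  move: hak; rewrite /h /= !dotE (dotC a0.1 (a k).1); nra.
(* The cluster point c is that of the sequence shifted by a0.1. *)
have [c cP] := bounded_seq_cluster _ _ bound.
exists (c + a0.1) => b Kb; apply/ler_addgt0Pl => e e0; rewrite addr0.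
pose B := 4 * (1 + h a0 + m) + 2 * dot (a0.1 - b.1) (a0.1 - b.1).
have B0 : 0 <= B.
  by have := Kpos _ Ka0; have := dot_ge0 (a0.1 - b.1); rewrite /B /h; lra.
have D0 : 0 < 3 + 2 * B + e by lra.
(* With B bounding |a k - b|^2, t k < eta and |a k - q| < eta <= 1, the errors
   are eta (1 + B) from [approx], eta B + eta from [young], and eta^2 <= eta:
   together eta (3 + 2 B) <= e. *)
pose eta := e / (3 + 2 * B + e).
have eta0 : 0 < eta by rewrite divr_gt0.
have etaE : eta * (3 + 2 * B + e) = e by rewrite divfK // gt_eqF.
have eta1 : eta <= 1 by rewrite ler_pdivrMr //; lra.
have [N tN] := tlim _ eta0.
have [k /tN tk] := cP _ N (exprn_gt0 2 eta0).
have /andP[t0 _] := t01 k.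
have := approx b k Kb; have := bound k.
move: ((a k).1) (c + a0.1) (addrK a0.1 c) => d q <- bd ap qd.
have dB : dot (d - b.1) (d - b.1) <= B.
  have := dot_ge0 (d - a0.1 - (a0.1 - b.1)); move: bd; rewrite /B.
  rewrite !dotE (dotC b.1 d) (dotC a0.1 d) (dotC b.1 a0.1); lra.
have young : 2 * dot (d - b.1) (q - d) <= eta * B + eta.
  rewrite -(ler_pM2l eta0).
  have := dot_ge0 (eta *: (d - b.1) - (q - d)).
  have -> : dot (eta *: (d - b.1) - (q - d)) (eta *: (d - b.1) - (q - d)) =
      eta ^+ 2 * dot (d - b.1) (d - b.1) - 2 * eta * dot (d - b.1) (q - d)
      + dot (q - d) (q - d).
    by rewrite !dotE (dotC b.1 d) (dotC q d) (dotC q b.1); ring.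
  have -> : dot (q - d) (q - d) = dot (d - a0.1 - (q - a0.1)) (d - a0.1 - (q - a0.1)).
    by rewrite !dotE (dotC a0.1 d) (dotC q d) (dotC a0.1 q); ring.
  have := ler_wpM2l (sqr_ge0 eta) dB; move: qd; lra.
have -> : dot q q - 2 * dot q b.1 - b.2 =
    (dot d d - 2 * dot d b.1 - b.2) + 2 * dot (d - b.1) (q - d) +
    dot (d - a0.1 - (q - a0.1)) (d - a0.1 - (q - a0.1)).
  rewrite !dotE (dotC b.1 d) (dotC q d) (dotC a0.1 d) (dotC a0.1 q) (dotC b.1 q).
  ring.
have : t k * (1 + dot (d - b.1) (d - b.1)) <= eta * (1 + B).
  apply: ler_pM; rewrite ?lerD2l // ?addr_ge0 ?dot_ge0 //; exact: ltW.
nra.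
Qed.

Section Minty.
Context {R : realType} {d : nat}.
Implicit Types A : @operator R d.

(** Otherwise the graph of A with (x, u) added would be a larger monotone
graph. *)
Lemma maximal_monotone_mem A x u : maximal_monotone A ->
  (forall y v, A y v -> 0 <= dot (x - y) (u - v)) -> A x u.
Proof.
move=> [Amon Amax] xu.
pose A' : @operator R d := fun y v => A y v \/ (y = x /\ v = u).
have A'mon : monotone_op A'.
  move=> y1 y2 v1 v2 [a1|[-> ->]] [a2|[-> ->]]; first exact: Amon.
  - by rewrite -opprB -(opprB u) dotNl dotNr opprK; exact: xu.
  - exact: xu.
  - by rewrite subrr dot0l.
by apply: (Amax A' A'mon) => [y v|]; [left | right].
Qed.

(** F x u p says that p is at least the value at (x, u) of the Fitzpatrick
function of A, the supremum of <x, v> + <y, u> - <y, v> over (y, v) in the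
graph. *)
Lemma minty0 A : maximal_monotone A -> exists c, A c (- c).
Proof.
move=> AM; have [Amon _] := AM.
pose F (x u : 'rV[R]_d) (p : R) :=
  forall y v, A y v -> dot x v + dot y u - dot y v <= p.
have FA y v : A y v -> F y v (dot y v).
  move=> Ayv y' v' Ayv'; have := Amon _ _ _ _ Ayv Ayv'; rewrite !dotE; lra.
have F_ge x u p : F x u p -> dot x u <= p.
  move=> Fp; rewrite leNgt; apply/negP => pxu.
  have Axu : A x u.
    apply: maximal_monotone_mem => // y v /Fp; rewrite !dotE; lra.
  have := Fp _ _ Axu; lra.
pose K : set ('rV[R]_d * R) :=
  [set a | exists x u, a.1 = 2^-1 *: (x - u) /\ F x u a.2].
have KA y v : A y v -> K (2^-1 *: (y - v), dot y v).
  by move=> Ayv; exists y, v; split => //=; exact: FA.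
have K0 : K !=set0.
  (* An empty graph is not maximal: (0, 0) could be added to it. *)
  apply: contrapT => K0; suff /KA K00 : A 0 0 by apply: K0; eexists; exact: K00.
  by apply: maximal_monotone_mem => // y v /KA Kyv; case: K0; eexists; exact: Kyv.
have Kcvx a b t : K a -> K b -> 0 <= t <= 1 ->
    K ((1 - t) *: a.1 + t *: b.1, (1 - t) * a.2 + t * b.2).
  move=> [x [u [-> xu]]] [x' [u' [-> xu']]] /andP[t0 t1].
  exists ((1 - t) *: x + t *: x'), ((1 - t) *: u + t *: u'); split => /=.
    by apply/rowP => i; rewrite !mxE; ring.
  move=> y v Ayv; have := xu _ _ Ayv; have := xu' _ _ Ayv.
  have t1' : 0 <= 1 - t by lra.
  move=> /(ler_wpM2l t0) + /(ler_wpM2l t1'); rewrite !dotE; lra.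
have Kpos a : K a -> 0 <= dot a.1 a.1 + a.2.
  move=> [x [u [-> /F_ge]]]; have := dot_ge0 (x + u).
  by rewrite !dotE (dotC u x); lra.
have [c cK] := convex_variational_ineq _ K0 Kcvx Kpos.
exists c; apply: maximal_monotone_mem => // y v /KA/cK /=.
rewrite !dotE (dotC y c); lra.
Qed.

(** The operator A' = alpha A - z is again maximal monotone, and - x in A' x
means z - x in alpha A x. *)
Lemma minty A (alpha : R) z : maximal_monotone A -> 0 < alpha ->
  exists x, A x (alpha^-1 *: (z - x)).
Proof.
move=> AM a0; have [Amon _] := AM.
have ai0 : 0 < alpha^-1 by rewrite invr_gt0.
pose A' : @operator R d := fun x u => A x (alpha^-1 *: (z + u)).
suff /minty0 : maximal_monotone A' by [].
split => [x y u v xu yv|B Bmon AB x u Bxu].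
  have := Amon _ _ _ _ xu yv.
  by rewrite -scalerBr (addrC z u) addrKA dotZr pmulr_rge0.
apply: (maximal_monotone_mem A) => // y v Ayv.
have Byv : B y (alpha *: v - z).
  by apply: AB; rewrite /A' addrC subrK scalerK // gt_eqF.
have := Bmon _ _ _ _ Bxu Byv.
rewrite -(pmulr_rge0 _ ai0) -dotZr opprB addrA scalerBr scalerK ?gt_eqF //.
by rewrite (addrC u).
Qed.

End Minty.


(** * Resolvents of maximal monotone operators *)

Section Resolvent.
Context {R : realType} {d : nat}.
Variables (A : operator R d) (alpha : R).
Hypotheses (Amax : maximal_monotone A) (alpha_gt0 : 0 < alpha).
Let J := resolvent (op_scale alpha A).

Lemma resolvent_setE z x :
  op_inv (op_add op_id (op_scale alpha A)) z x <-> A x (alpha^-1 *: (z - x)).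
Proof.
split=> [[_ -> [_ [u Axu <-] <-]]|Ax].
  by rewrite addrC addKr scalerK // gt_eqF.
exists x => //; exists (z - x); last by rewrite addrC subrK.
by exists (alpha^-1 *: (z - x)); rewrite // scalerKV // gt_eqF.
Qed.

Lemma resolventP z : A (J z) (alpha^-1 *: (z - J z)).
Proof.
apply/resolvent_setE; apply: xgetPex.
by have [x /resolvent_setE] := minty A alpha z Amax alpha_gt0; exists x.
Qed.

(** Firm nonexpansiveness, the form in which monotonicity enters the
averagedness estimate. *)
Lemma resolvent_firm z w :
  0 <= dot (J z - J w) ((z - w) - (J z - J w)).
Proof.
have := Amax.1 _ _ _ _ (resolventP z) (resolventP w).
rewrite -scalerBr dotZr pmulr_rge0 ?invr_gt0 //.
by congr (0 <= dot _ _); apply/rowP => i; rewrite !mxE; ring.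
Qed.

Lemma resolventK x u : A x u -> J (x + alpha *: u) = x.
Proof.
move=> Axu; set z := x + _; apply/eqP; rewrite -subr_eq0; apply/eqP/dot_eq0.
have := Amax.1 _ _ _ _ (resolventP z) Axu.
have -> : alpha^-1 *: (z - J z) - u = alpha^-1 *: - (J z - x).
  rewrite -[u in LHS](scalerK (lt0r_neq0 alpha_gt0)) -scalerBr; congr (_ *: _).
  by rewrite /z; apply/rowP => i; rewrite !mxE; ring.
by rewrite dotZr dotNr pmulr_rge0 ?invr_gt0 // oppr_ge0.
Qed.

End Resolvent.

(** * The three-operator splitting *)

(** The computation behind averagedness, on differences of two instances of
the iteration: twice the sum of the three hypotheses and |x1 - x2|^2 >= 0
bound 2<z, r> + |r|^2 / theta by 0. *)
Lemma split_averaged {R : realType} {d : nat} (theta : R)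
    (z1 z2 x1 x2 x3 : 'rV[R]_d) (z r : 'rV[R]_(d + d)) :
  0 < theta ->
  z = row_mx z1 z2 -> r = theta *: row_mx (x3 - x1) (x3 - x2) ->
  0 <= dot x1 (z1 - x1) ->
  0 <= dot x2 (x1 + z2 - x2) ->
  0 <= dot x3 (x1 - z1 + x2 - z2 - x3) ->
  dot (z + r) (z + r) + (1 - theta) / theta * dot r r <= dot z z.
Proof.
move=> t0 zE rE h1 h2 h3; have t0' : theta != 0 by rewrite gt_eqF.
suff : 2 * dot z r + theta^-1 * dot r r <= 0.
  have -> : (1 - theta) / theta = theta^-1 - 1 by rewrite mulrBl mul1r divff.
  rewrite !dotE (dotC r z); lra.
rewrite zE rE !dotZr !dotZl !dot_row_mx.
set P := dot z1 _ + _; set Q := dot _ _ + dot _ _.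
have -> : 2 * (theta * P) + theta^-1 * (theta * (theta * Q)) = theta * (2 * P + Q).
  by field.
rewrite pmulr_rle0 // /P /Q; have := dot_ge0 (x1 - x2); move: h1 h2 h3.
rewrite !dotE (dotC x3 x1) (dotC x3 x2) (dotC x2 x1).
rewrite (dotC z1 x1) (dotC z1 x3) (dotC z2 x2) (dotC z2 x3); lra.
Qed.

Section Splitting.
Context {R : realType} {d : nat} (alpha theta : R).
Hypotheses (alpha_gt0 : 0 < alpha) (theta_gt0 : 0 < theta).
Variables A B C : maxmon R d.
Let T := split_T alpha theta A B C.

Lemma split_T_averaged z w :
  dot (T z - T w) (T z - T w) +
  (1 - theta) / theta * dot ((T z - z) - (T w - w)) ((T z - z) - (T w - w)) <=
  dot (z - w) (z - w).
Proof.
have hA := resolvent_firm _ _ (maxmonP A) alpha_gt0 (lsubmx z) (lsubmx w).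
have hB := resolvent_firm _ _ (maxmonP B) alpha_gt0
  (split_x1 alpha A z + rsubmx z) (split_x1 alpha A w + rsubmx w).
have hC := resolvent_firm _ _ (maxmonP C) alpha_gt0
  (split_x1 alpha A z - lsubmx z + split_x2 alpha A B z - rsubmx z)
  (split_x1 alpha A w - lsubmx w + split_x2 alpha A B w - rsubmx w).
rewrite -!/(split_x1 _ _ _) -!/(split_x2 _ _ _ _) -!/(split_x3 _ _ _ _ _) in hA hB hC.
have step v : T v - v = theta *: row_mx (split_x3 alpha A B C v - split_x1 alpha A v)
                                   (split_x3 alpha A B C v - split_x2 alpha A B v).
  rewrite /T /split_T -[X in _ - X](hsubmxK v) opp_row_mx add_row_mx scale_row_mx.
  by congr row_mx; rewrite addrC addKr.
have -> : T z - T w = (z - w) + ((T z - z) - (T w - w)).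
  by apply/rowP => i; rewrite !mxE; ring.
apply: (@split_averaged _ _ _ (lsubmx z - lsubmx w) (rsubmx z - rsubmx w)
  (split_x1 alpha A z - split_x1 alpha A w)
  (split_x2 alpha A B z - split_x2 alpha A B w)
  (split_x3 alpha A B C z - split_x3 alpha A B C w)) => //.
- by rewrite -[in LHS](hsubmxK z) -[in LHS](hsubmxK w) opp_row_mx add_row_mx.
- rewrite !step -scalerBr opp_row_mx add_row_mx.
  by congr (_ *: row_mx _ _); apply/rowP => i; rewrite !mxE; ring.
- by move: hB; congr (0 <= dot _ _); apply/rowP => i; rewrite !mxE; ring.
by move: hC; congr (0 <= dot _ _); apply/rowP => i; rewrite !mxE; ring.
Qed.

Lemma split_fixedP x :
  (exists z, T z = z /\ split_S alpha A B C z = x) <->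
  op_add (op_add A B) C x 0.
Proof.
have a_neq0 : alpha != 0 by rewrite gt_eqF.
split.
  move=> [z [Tz <-]].
  have cancel_step (u v w : 'rV[R]_d) : u + theta *: (v - w) = u -> v = w.
    rewrite -[RHS]addr0 => /addrI/eqP.
    by rewrite scaler_eq0 gt_eqF //= subr_eq0 => /eqP.
  move: Tz; rewrite /T /split_T -[X in _ = X]hsubmxK => /eq_row_mx[].
  move=> /cancel_step e31 /cancel_step e32.
  have e21 : split_x2 alpha A B z = split_x1 alpha A z by rewrite -e32 e31.
  have := resolventP _ _ (maxmonP A) alpha_gt0 (lsubmx z).
  have := resolventP _ _ (maxmonP B) alpha_gt0 (split_x1 alpha A z + rsubmx z).
  have := resolventP _ _ (maxmonP C) alpha_gt0
    (split_x1 alpha A z - lsubmx z + split_x2 alpha A B z - rsubmx z).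
  rewrite -!/(split_x1 _ _ _) -!/(split_x2 _ _ _ _) -!/(split_x3 _ _ _ _ _).
  rewrite /split_S e31 e21; set x1 := split_x1 _ _ _ => Cx Bx Ax.
  have -> : 3^-1 *: (x1 + x1 + x1) = x1.
    by apply/rowP => i; rewrite !mxE; field.
  exists (alpha^-1 *: (lsubmx z - x1) + alpha^-1 *: (x1 + rsubmx z - x1)).
    by exists (alpha^-1 *: (lsubmx z - x1)) => //; eexists; first exact: Bx.
  eexists; first exact: Cx.
  by apply/rowP => i; rewrite !mxE; ring.
move=> [_ [a Ax [b Bx <-]] [c Cx abc]].
pose z := row_mx (x + alpha *: a) (alpha *: b).
have x1E : split_x1 alpha A z = x by rewrite /split_x1 row_mxKl (resolventK _ _ (maxmonP _)).
have x2E : split_x2 alpha A B z = x by rewrite /split_x2 x1E row_mxKr (resolventK _ _ (maxmonP _)).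
have x3E : split_x3 alpha A B C z = x.
  rewrite /split_x3 x1E x2E row_mxKl row_mxKr.
  rewrite [X in resolvent _ X](_ : _ = x + alpha *: c) ?(resolventK _ _ (maxmonP _)) //.
  have -> : c = - (a + b) by apply/eqP; rewrite -addr_eq0 addrC abc.
  by apply/rowP => i; rewrite !mxE; ring.
exists z; split.
  by rewrite /T /split_T x1E x2E x3E !subrr !scaler0 !addr0 hsubmxK.
by rewrite /split_S x1E x2E x3E; apply/rowP => i; rewrite !mxE; field.
Qed.

End Splitting.

Theorem theorem4 (R : realType) (d : nat) (alpha theta : R) :
  (0 < d)%N -> 0 < alpha -> 0 < theta < 1 ->
  fixed_point_encoding (@split_T R d alpha theta) (@split_S R d alpha) /\
  converges_unconditionally (@split_T R d alpha theta) (@split_S R d alpha).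
Proof.
move=> _ alpha_gt0 /andP[theta_gt0 theta_lt1].
split=> [A B C x|A B C [x /split_fixedP xE] z0]; first exact: split_fixedP.
have kappa_gt0 : 0 < (1 - theta) / theta by rewrite divr_gt0 // subr_gt0.
have [w [Tw _]] := xE _ _ alpha_gt0 theta_gt0.
have [z zlim Tz] := averaged_iter_cvg _ _ kappa_gt0
  (split_T_averaged _ _ alpha_gt0 theta_gt0 A B C) w z0 Tw.
exists z => //; apply/(split_fixedP alpha theta alpha_gt0 theta_gt0).
by exists z.
Qed.
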